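(* Let $K$ and $L$ be two finite simplicial complexes. If the associated finite spaces $\mathcal{X}(K)$ and $\mathcal{X}(L)$ are homotopy equivalent, then $K$ and $L$ have the same strong homotopy type.
   Context: All simplicial complexes are finite (simplices are nonempty finite sets of vertices). For a vertex $v$ of a complex $K$, the link $\mathrm{lk}_K(v)$ is the subcomplex of simplices $\tau\in K$ with $v\notin\tau$ and $\tau\cup\{v\}\in K$, and $K\smallsetminus v$ is the full subcomplex of $K$ spanned by the vertices different from $v$. A simplicial cone is a complex $aM$, the join of a (possibly empty) complex $M$ and a vertex $a$ not in $M$; its simplices are $\{a\}$, the simplices $\tau$ of $M$, and the sets $\{a\}\cup\tau$ with $\tau\in M$. A vertex $v$ of $K$ is dominated if $\mathrm{lk}_K(v)$ is a simplicial cone; in that case there is an elementary strong collapse from $K$ to $K\smallsetminus v$. A strong collapse from $K$ to a subcomplex $L$ is a finite (possibly empty) sequence of elementary strong collapses starting in $K$ and ending in $L$; its inverse is a strong expansion. Two complexes have the same strong homotopy type if there is a sequence of strong collapses and strong expansions that starts in one and ends in the other. Finite $T_0$-spaces are identified with finite posets: $x\le y$ if and only if $x\in U_y$, where $U_y$ is the minimal open set containing $y$ (so the open sets are the down-sets). Homotopy equivalence of finite $T_0$-spaces is the usual topological notion. For a complex $K$, $\mathcal{X}(K)$ is the finite $T_0$-space corresponding to the poset of simplices of $K$ ordered by inclusion. *)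

(* Defs.v *)
From HB Require Import structures.
From Stdlib Require Import Relation_Operators.
From mathcomp Require Import all_boot all_order all_algebra finmap.
From mathcomp Require Import all_classical all_reals all_analysis.

Set Implicit Arguments.
Unset Strict Implicit.
Unset Printing Implicit Defensive.

Import Order.TTheory GRing.Theory Num.Theory.
Import numFieldNormedType.Exports.

Local Open Scope fset_scope.

Section Complexes.
Context {V : choiceType}.
Implicit Types (v a : V) (s t : {fset V}).

Definition is_complex (S : {fset {fset V}}) : bool :=
  (fset0 \notin S) && [forall s : S, fpowerset (fsval s) `\ fset0 `<=` S].

Lemma is_complexP (S : {fset {fset V}}) :
  reflect (fset0 \notin S /\
           forall s t, s \in S -> t `<=` s -> t != fset0 -> t \in S)
          (is_complex S).
Proof.
apply: (iffP andP) => -[S0 H]; split=> //.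
  move=> s t sS ts t0; have /fsubsetP := forallP H [` sS]; apply.
  by rewrite !inE t0 fpowersetE.
apply/forallP => s; apply/fsubsetP => t; rewrite !inE fpowersetE => /andP[t0 ts].
exact: (H _ _ (fsvalP s) ts t0).
Qed.

End Complexes.

(* The vertices of [K] are the [v] with [[fset v] \in K]; the points of [V]
   that are not vertices play no role: [V] is a universe of possible vertices
   shared by the complexes under comparison.  Strong expansions add vertices,
   so results about strong homotopy types assume [V] infinite, which makes
   fresh vertices always available.  The empty complex is allowed. *)
Record scomplex (V : choiceType) := SComplex {
  simplices :> {fset {fset V}};
  scomplexP : is_complex simplices
}.

HB.instance Definition _ (V : choiceType) := [isSub for @simplices V].
HB.instance Definition _ (V : choiceType) := [Choice of scomplex V by <:].

Section StrongCollapses.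
Context {V : choiceType}.
Implicit Types (K L M : scomplex V) (v a : V) (s t : {fset V}).

Definition link_set K v : {fset {fset V}} :=
  [fset t in simplices K | (v \notin t) && (v |` t \in simplices K)].

Lemma link_subproof K v : is_complex (link_set K v).
Proof.
have /is_complexP[K0 Kd] := scomplexP K.
apply/is_complexP; split=> [|s t]; first by rewrite !inE (negPf K0).
rewrite !inE => /and3P[sK vs vsK] ts t0; apply/and3P; split.
- exact: Kd sK ts t0.
- by apply: contra vs; apply/fsubsetP.
- apply: Kd vsK (fsetUS _ ts) _.
  by apply/fset0Pn; exists v; rewrite !inE eqxx.
Qed.

Definition link K v : scomplex V := SComplex (link_subproof K v).

Definition deletion_set K v : {fset {fset V}} :=
  [fset t in simplices K | v \notin t].

Lemma deletion_subproof K v : is_complex (deletion_set K v).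
Proof.
have /is_complexP[K0 Kd] := scomplexP K.
apply/is_complexP; split=> [|s t]; first by rewrite !inE (negPf K0).
rewrite !inE => /andP[sK vs] ts t0; rewrite (Kd s t) //=.
by apply: contra vs; apply/fsubsetP.
Qed.

Definition deletion K v : scomplex V := SComplex (deletion_subproof K v).

Definition cone_set a M : {fset {fset V}} :=
  [fset a] |` (simplices M `|` [fset a |` t | t in simplices M]).

Definition is_cone K : Prop :=
  exists (a : V) (M : scomplex V),
    [fset a] \notin simplices M /\ simplices K = cone_set a M.

Definition dominated K v : Prop :=
  [fset v] \in simplices K /\ is_cone (link K v).

Definition elementary_strong_collapse K L : Prop :=
  exists v : V, dominated K v /\ L = deletion K v.

Definition strong_collapse K L : Prop :=
  clos_refl_trans _ elementary_strong_collapse K L.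

Definition strong_expansion K L : Prop := strong_collapse L K.

Definition same_strong_homotopy_type K L : Prop :=
  clos_refl_trans _
    (fun A B => strong_collapse A B \/ strong_expansion A B) K L.

End StrongCollapses.

(* The finite T0-space of a finite poset: open sets are the down-sets. *)
Definition finite_space {d} (T : finPOrderType d) : Type := T.

Section FiniteSpace.
Context {d} {T : finPOrderType d}.

Definition downset (A : set T) : Prop := forall x y : T, (x <= y)%O -> A y -> A x.

Lemma downsetT : downset setT. Proof. by []. Qed.

Lemma downsetI : setI_closed downset.
Proof. by move=> A B dA dB x y xy [/(dA _ _ xy) ? /(dB _ _ xy)]. Qed.

Lemma downset_bigcup (I : Type) (f : I -> set T) :
  (forall i, downset (f i)) -> downset (\bigcup_i f i)%classic.
Proof. by move=> df x y xy [i _ /(df i _ _ xy)]; exists i. Qed.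

HB.instance Definition _ := Finite.on (finite_space T).
HB.instance Definition _ :=
  isOpenTopological.Build (finite_space T) downsetT downsetI downset_bigcup.

End FiniteSpace.

Section FacePoset.
Context {V : choiceType} (K : scomplex V).

Definition face_poset : Type := simplices K.

HB.instance Definition _ := Finite.on face_poset.

Definition face_le (s t : face_poset) : bool := fsval s `<=` fsval t.

Lemma face_le_refl : reflexive face_le.
Proof. by move=> s; exact: fsubset_refl. Qed.

Lemma face_le_anti : antisymmetric face_le.
Proof. by move=> s t; rewrite /face_le -eqEfsubset => /eqP /val_inj. Qed.

Lemma face_le_trans : transitive face_le.
Proof. by move=> t s u; exact: fsubset_trans. Qed.

HB.instance Definition _ := Order.Le_isPOrder.Build (Order.Disp tt tt)
  face_poset face_le_refl face_le_anti face_le_trans.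

End FacePoset.

Definition face_space {V : choiceType} (K : scomplex V) : topologicalType :=
  finite_space (face_poset K).

Section Homotopy.
Local Open Scope classical_set_scope.
Local Open Scope ring_scope.
Context (R : realType).

(* A homotopy X * [0, 1] -> Y is the restriction of a total map on X * R, of
   which only the values on X * [0, 1] matter. *)
Definition homotopic {X Y : topologicalType} (f g : X -> Y) : Prop :=
  exists H : X * R -> Y,
    [/\ {within [set: X] `*` `[0, 1], continuous H},
        forall x, H (x, 0) = f x &
        forall x, H (x, 1) = g x].

Definition homotopy_equivalent (X Y : topologicalType) : Prop :=
  exists (f : X -> Y) (g : Y -> X),
    [/\ continuous f, continuous g,
        homotopic (g \o f) idfun & homotopic (f \o g) idfun].

End Homotopy.

(* Main.v *)
(* A point of X(K) is a simplex, so a monotone map F : X(K) -> X(L) admits a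
   selection: a vertex map f sending each simplex x into F x.  Selections are
   simplicial, two selections of F are contiguous, selections of F are
   selections of every G >= F, and they compose.  A homotopy between finite
   spaces is, around each time t, pointwise below its value at t; by
   connectedness of [0, 1], selections of homotopic maps lie in one contiguity
   class, so a homotopy equivalence of X(K) and X(L) gives simplicial maps
   between K and L that are mutually inverse up to contiguity.  Strong
   collapses also provide such maps, so they exist between cores of K and L;
   as a map in the contiguity class of the identity of a core is the identity,
   the cores are isomorphic.  Isomorphic complexes are related by renaming
   vertices one at a time through fresh vertices, each renaming being a strong
   expansion followed by a strong collapse. *)
Require Import Defs.
From Stdlib Require Import Relation_Operators.
From mathcomp Require Import all_boot all_order all_algebra finmap.
From mathcomp Require Import all_classical all_reals all_analysis.

Set Implicit Arguments.
Unset Strict Implicit.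
Unset Printing Implicit Defensive.

Import Order.TTheory Num.Theory.
Import numFieldNormedType.Exports.

(** * Simplices, vertices and dominated vertices *)

Section Complexes.
Local Open Scope fset_scope.
Context {V : choiceType}.
Implicit Types (K L M : scomplex V) (f g h k : V -> V) (s t : {fset V}).

Lemma simplex_neq0 K s : s \in simplices K -> s != fset0.
Proof.
by have /is_complexP[K0 _] := scomplexP K; apply: contraTneq => ->.
Qed.

Lemma simplex_subset K s t :
  s \in simplices K -> t `<=` s -> t != fset0 -> t \in simplices K.
Proof. by have /is_complexP[_] := scomplexP K; apply. Qed.

Lemma scomplex_eq K L : simplices K = simplices L -> K = L.
Proof. exact: val_inj. Qed.

Definition vertices K : {fset V} := \bigcup_(s <- simplices K) s.

Lemma simplex_vertices K s : s \in simplices K -> s `<=` vertices K.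
Proof. by move=> sK; exact: (bigfcup_sup _ sK). Qed.

Lemma simplex_mem_vertices K s v :
  s \in simplices K -> v \in s -> v \in vertices K.
Proof. by move=> /simplex_vertices /fsubsetP; apply. Qed.

Lemma fset1_neq0 (v : V) : [fset v] != fset0.
Proof. by apply/fset0Pn; exists v; rewrite inE. Qed.

Lemma vertexP K v : v \in vertices K = ([fset v] \in simplices K).
Proof.
apply/bigfcupP/idP => [[s /andP[sK _] vs]|vK]; last first.
  by exists [fset v]; rewrite ?vK // inE.
by apply: simplex_subset sK _ (fset1_neq0 v); rewrite fsub1set.
Qed.

Lemma imfset_eq0 f s : (f @` s == fset0) = (s == fset0).
Proof.
apply/eqP/eqP => [fs0|->]; last exact: imfset0.
apply/eqP; rewrite -[_ == _]negbK; apply/negP => /fset0Pn[v vs].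
by have := in_imfset imfset_key f vs; rewrite /= fs0.
Qed.

Lemma imfset_comp_fset f g s : (f \o g) @` s = f @` (g @` s).
Proof. exact: imfset_comp. Qed.

Lemma eq_imfset_fset f g s : {in s, f =1 g} -> f @` s = g @` s.
Proof. by move=> fg; apply: eq_in_imfset. Qed.

Lemma imfset_id_in f s : {in s, f =1 id} -> f @` s = s.
Proof. by move=> /eq_imfset_fset ->; rewrite imfset_id. Qed.

(** The apex of the cone [link K v] serves as [a]: a cone is closed under adding its apex, and this
    is applied to [s] with [v] removed. Conversely, such an [a] makes the link a cone with apex [a]
    over its own deletion of [a]. *)
Lemma dominatedP K v :
  dominated K v <-> [fset v] \in simplices K /\
    exists2 a, a != v & forall s, s \in simplices K -> v \in s ->
      a |` s \in simplices K.
Proof.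
split=> [[vK [a [M [aM cK]]]]|[vK [a av domv]]]; split=> //.
  have : [fset a] \in simplices (link K v) by rewrite cK !inE eqxx.
  rewrite !inE => /and3P[aK va avK].
  exists a => [|s sK vs]; first by rewrite eq_sym.
  have [->|sv] := eqVneq s [fset v].
    by rewrite fsetUC.
  have : s `\ v \in simplices (link K v).
    rewrite !inE eqxx fsetD1K // sK /= !andbT.
    apply: simplex_subset sK (fsubD1set _ _) _.
    apply: contra sv; rewrite fsetD_eq0 => ss.
    by rewrite eqEfsubset ss fsub1set.
  rewrite cK.
  have aL t : t \in cone_set a M -> a |` t \in cone_set a M.
    rewrite !inE => /or3P[/eqP->|tM|/imfsetP[u /= uM ->]].
    - by rewrite fsetUid eqxx.
    - by rewrite in_imfset ?orbT.
    - by rewrite fsetUA fsetUid in_imfset ?orbT.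
  move/aL; rewrite -cK !inE => /and3P[_ _].
  by rewrite fsetUCA fsetD1K.
exists a, (deletion (link K v) a); split; first by rewrite !inE eqxx andbF.
apply/fsetP => s; apply/idP/idP => [|]; last first.
  rewrite !inE => /or3P[/eqP->|/andP[]|/imfsetP[t /=]].
  - have avK : a |` [fset v] \in simplices K by rewrite domv ?inE.
    rewrite fsetUC avK !inE eq_sym av andbT /= andbT.
    by apply: simplex_subset avK (fsubsetUl _ _) (fset1_neq0 a).
  - by move=> ->.
  - rewrite !inE => /andP[/and3P[tK vt vtK] at_] ->.
    have avtK : a |` (v |` t) \in simplices K by rewrite domv // !inE eqxx.
    rewrite fsetUCA avtK andbT !inE eq_sym (negPf av) (negPf vt) /= andbT.
    apply: simplex_subset avtK _ _; first by rewrite fsetUS // fsubsetUr.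
    by apply/fset0Pn; exists a; rewrite !inE eqxx.
move=> sL; have [as_|as_] := boolP (a \in s); last first.
  by move: sL; rewrite !inE as_ => ->; rewrite orbT.
have [->|sa] := eqVneq s [fset a]; first by rewrite !inE eqxx.
have -> : s = a |` (s `\ a) by rewrite fsetD1K.
rewrite !inE; apply/or3P; apply: Or33.
apply: in_imfset => /=; rewrite !inE eqxx /= andbT.
have sa0 : s `\ a != fset0.
  apply: contra sa; rewrite fsetD_eq0 => ss.
  by rewrite eqEfsubset ss fsub1set.
have : s `\ a \in simplices (link K v).
  by apply: simplex_subset sL (fsubD1set _ _) sa0.
by rewrite !inE.
Qed.

(** * Simplicial maps, contiguity classes and equivalences up to contiguity *)

Definition simplicial K L f : Prop :=
  forall s, s \in simplices K -> f @` s \in simplices L.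

Definition contiguous K L f g : Prop :=
  forall s, s \in simplices K -> f @` s `|` g @` s \in simplices L.

Definition contiguity K L : (V -> V) -> (V -> V) -> Prop :=
  clos_refl_trans _ (contiguous K L).

Lemma contiguity_postcomp K L M h f g : simplicial L M h ->
  contiguity K L f g -> contiguity K M (h \o f) (h \o g).
Proof.
move=> hLM; elim=> {f g} [f g fg|f|f g k _ fg _ gk].
- apply: rt_step => s sK.
  rewrite (imfset_comp_fset h f) (imfset_comp_fset h g) -imfsetU.
  exact/hLM/fg.
- exact: rt_refl.
- exact: rt_trans fg gk.
Qed.

Lemma contiguity_precomp K L M h f g : simplicial K L h ->
  contiguity L M f g -> contiguity K M (f \o h) (g \o h).
Proof.
move=> hKL; elim=> {f g} [f g fg|f|f g k _ fg _ gk].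
- apply: rt_step => s sK.
  rewrite (imfset_comp_fset f h) (imfset_comp_fset g h).
  exact/fg/hKL.
- exact: rt_refl.
- exact: rt_trans fg gk.
Qed.

Definition strong_equivalent K L : Prop :=
  exists f g, [/\ simplicial K L f, simplicial L K g,
    contiguity K K (g \o f) id & contiguity L L (f \o g) id].

Lemma strong_equivalent_refl K : strong_equivalent K K.
Proof.
have idK : simplicial K K id by move=> s; rewrite imfset_id.
by exists id, id; split=> //; exact: rt_refl.
Qed.

Lemma strong_equivalent_sym K L :
  strong_equivalent K L -> strong_equivalent L K.
Proof. by move=> [f [g [*]]]; exists g, f; split. Qed.

Lemma strong_equivalent_trans L K M :
  strong_equivalent K L -> strong_equivalent L M -> strong_equivalent K M.
Proof.
move=> [f [g [fKL gLK gf fg]]] [h [k [hLM kML kh hk]]].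
exists (h \o f), (g \o k); split.
- by move=> s sK; rewrite imfset_comp_fset; apply/hLM/fKL.
- by move=> s sM; rewrite imfset_comp_fset; apply/gLK/kML.
- apply: rt_trans gf.
  exact: (contiguity_postcomp gLK (contiguity_precomp fKL kh)).
- apply: rt_trans hk.
  exact: (contiguity_postcomp hLM (contiguity_precomp kML fg)).
Qed.

Definition relabel (v w : V) : V -> V := fun u => if u == v then w else u.

Lemma relabel_imfset_notin v w s : v \notin s -> relabel v w @` s = s.
Proof.
move=> vs; apply: imfset_id_in => u us; rewrite /relabel.
by case: eqP => // uv; rewrite -uv us in vs.
Qed.

Lemma relabel_imfset_in v w s : v \in s -> relabel v w @` s = w |` (s `\ v).
Proof.
move=> /fsetD1K/(congr1 (fun t : {fset V} => relabel v w @` t))/= <-.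
by rewrite imfsetU1 {1}/relabel eqxx relabel_imfset_notin // !inE eqxx.
Qed.

(** The retraction sends the dominated vertex [v] to a dominating vertex [a]. It is contiguous to
    the identity because adding [a] to a simplex through [v] gives a simplex again. *)
Lemma elementary_strong_collapse_equivalent K L :
  elementary_strong_collapse K L -> strong_equivalent K L.
Proof.
move=> [v [/dominatedP[vK [a av domv]] ->]].
exists (relabel v a), id; split.
- move=> s sK; rewrite !inE.
  have [vs|vs] := boolP (v \in s); last by rewrite relabel_imfset_notin ?sK.
  rewrite relabel_imfset_in // !inE eqxx eq_sym (negPf av) /= andbT.
  apply: simplex_subset (domv _ sK vs) (fsetUS _ (fsubD1set _ _)) _.
  by apply/fset0Pn; exists a; rewrite !inE eqxx.
- by move=> s; rewrite imfset_id !inE => /andP[].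
- apply: rt_step => s sK; rewrite imfset_id /=.
  have [vs|vs] := boolP (v \in s); last first.
    by rewrite relabel_imfset_notin ?fsetUid.
  by rewrite relabel_imfset_in // -fsetUA (fsetUidPr _ _ (fsubD1set _ _)) domv.
- apply: rt_step => s sD; rewrite imfset_id /=.
  have vs : v \notin s by move: sD; rewrite !inE => /andP[].
  by rewrite relabel_imfset_notin ?fsetUid.
Qed.

Lemma strong_collapse_equivalent K L :
  strong_collapse K L -> strong_equivalent K L.
Proof.
elim=> [{}K {}L /elementary_strong_collapse_equivalent //|M|M N P _ MN _ NP].
  exact: strong_equivalent_refl.
exact: strong_equivalent_trans MN NP.
Qed.

(** * Cores and their rigidity *)

Definition minimal_complex K : Prop := forall v, ~ dominated K v.

Lemma strong_core K : exists2 L, strong_collapse K L & minimal_complex L.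
Proof.
have [n] := ubnP #|` simplices K|; elim: n K => // n IHn K Kn.
have [minK|/existsNP[v /contrapT domv]] := pselect (minimal_complex K).
  by exists K => //; exact: rt_refl.
have [|L DL minL] := IHn (deletion K v).
  rewrite -ltnS; apply: leq_trans Kn; rewrite ltnS; apply: fproper_ltn_card.
  have [vK _] := domv; apply/andP; split.
    by apply/fsubsetP => s; rewrite !inE => /andP[].
  by apply/fsubsetPn; exists [fset v] => //; rewrite !inE eqxx andbF.
by exists L => //; apply: rt_trans DL; apply: rt_step; exists v.
Qed.

(** If [f] is contiguous to a map fixing all vertices and moves [v], then [f v] dominates [v].
    Asking [g] to be the identity only on vertices lets the property travel backwards along a chain
    of contiguous maps. *)
Lemma minimal_contiguity_id K f g : minimal_complex K ->
  contiguity K K f g -> {in vertices K, g =1 id} -> {in vertices K, f =1 id}.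
Proof.
move=> minK; elim=> {f g} [f g fg gid|//|f g k _ fg _ gk kid]; last exact/fg/gk.
move=> v vK; apply: contrapT => /eqP fv; case: (minK v).
apply/dominatedP; split; first by rewrite -vertexP.
exists (f v) => // s sK vs; apply: simplex_subset (fg _ sK) _ _; last first.
  by apply/fset0Pn; exists (f v); rewrite !inE eqxx.
rewrite (@imfset_id_in g) ?fsetSU ?fsub1set ?in_imfset //.
by move=> u us; apply/gid/(simplex_mem_vertices sK us).
Qed.

(** * Images of complexes under vertex maps *)

Definition image_set f K : {fset {fset V}} :=
  [fset f @` (s : {fset V}) | s in simplices K].

(** A nonempty subset [t] of the image of [s] is the image of the face of [s] formed by the vertices
    sent into [t]; injectivity of [f] is not assumed. *)
Lemma image_subproof f K : is_complex (image_set f K).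
Proof.
apply/is_complexP; split=> [|_ t /imfsetP[s /= sK ->] /fsubsetP ts t0].
  apply/imfsetP => -[s /= /simplex_neq0 s0] /esym/eqP.
  by rewrite imfset_eq0 (negPf s0).
have tE : t = f @` [fset v in s | f v \in t].
  apply/fsetP => w; apply/idP/imfsetP => [wt|[v /= + ->]]; last first.
    by rewrite !inE => /andP[].
  have /imfsetP[v /= vs wE] := ts _ wt.
  by exists v; rewrite //= !inE vs -wE wt.
rewrite tE; apply: in_imfset => /=; apply: simplex_subset sK _ _.
  by apply/fsubsetP => v; rewrite !inE => /andP[].
by rewrite -(imfset_eq0 f) -tE.
Qed.

Definition image_complex f K : scomplex V := SComplex (image_subproof f K).

Lemma image_complex_comp f g K :
  image_complex (f \o g) K = image_complex f (image_complex g K).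
Proof.
apply: scomplex_eq; apply/fsetP => t; apply/imfsetP/imfsetP.
  move=> [s /= sK ->]; exists (g @` s); rewrite ?(imfset_comp_fset f g) //=.
  exact: in_imfset.
move=> [_ /= /imfsetP[s /= sK ->] ->].
by exists s; rewrite ?(imfset_comp_fset f g).
Qed.

Lemma eq_image_complex f g K :
  {in vertices K, f =1 g} -> image_complex f K = image_complex g K.
Proof.
move=> fg; apply: scomplex_eq; apply: eq_in_imfset => s /= sK.
by apply: eq_imfset_fset => v /(simplex_mem_vertices sK)/fg.
Qed.

Lemma image_complex_id f K : {in vertices K, f =1 id} -> image_complex f K = K.
Proof.
move=> /eq_image_complex ->; apply: scomplex_eq; rewrite /= -[RHS]imfset_id.
by apply: eq_in_imfset => s _ /=; rewrite imfset_id.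
Qed.

Lemma vertices_image f K : vertices (image_complex f K) = f @` vertices K.
Proof.
apply/fsetP => w; apply/idP/imfsetP => [|[v /= vK ->]].
  rewrite vertexP => /imfsetP[s /= sK wE].
  have : w \in f @` s by rewrite -wE inE.
  by case/imfsetP => v /= vs ->; exists v => //; exact: simplex_mem_vertices vs.
rewrite vertexP -imfset_fset1; apply: in_imfset => /=.
by rewrite -vertexP.
Qed.

Lemma simplicial_image_subset K L f :
  simplicial K L f -> {subset simplices (image_complex f K) <= simplices L}.
Proof. by move=> fKL _ /imfsetP[s /= /fKL fsL ->]. Qed.

(** By minimality both composites fix all vertices, so a simplex of [L] is the image under [f] of
    its image under [g]. Isomorphism is expressed as an image under a map with a left inverse on
    vertices. *)
Lemma minimal_equivalent_iso K L :
  minimal_complex K -> minimal_complex L -> strong_equivalent K L ->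
  exists f g, L = image_complex f K /\ {in vertices K, g \o f =1 id}.
Proof.
move=> minK minL [f [g [fKL gLK gf fg]]].
have gfid : {in vertices K, g \o f =1 id} by apply: minimal_contiguity_id gf _.
have fgid : {in vertices L, f \o g =1 id} by apply: minimal_contiguity_id fg _.
exists f, g; split=> //; apply: scomplex_eq; apply/fsetP => s.
apply/idP/idP => [sL|/(simplicial_image_subset fKL) //].
rewrite -(@imfset_id_in (f \o g) s) => [|v vs]; last first.
  exact/fgid/(simplex_mem_vertices sL).
by rewrite imfset_comp_fset; apply/in_imfset/gLK.
Qed.

Lemma same_type_sym K L :
  same_strong_homotopy_type K L -> same_strong_homotopy_type L K.
Proof.
elim=> [{}K {}L [KL|KL]|M|M N P _ MN _ NP].
- by apply: rt_step; right.
- by apply: rt_step; left.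
- exact: rt_refl.
- exact: rt_trans NP MN.
Qed.

Lemma strong_collapse_same_type K L :
  strong_collapse K L -> same_strong_homotopy_type K L.
Proof. by move=> KL; apply: rt_step; left. Qed.

End Complexes.

(** * Renaming vertices within a strong homotopy type *)

Section Relabelling.
Local Open Scope fset_scope.
Context {V : choiceType}.
Implicit Types (K L M : scomplex V) (f g h k : V -> V) (s t : {fset V}).

(** This is the largest complex with vertices in [A] on which [f] is simplicial into [K]; the bound
    [A] keeps it finite. *)
Definition preimage_set f (A : {fset V}) K : {fset {fset V}} :=
  [fset t in fpowerset A |
    (t != fset0) && (f @` (t : {fset V}) \in simplices K)].

Lemma in_preimage_set f (A : {fset V}) K t : (t \in preimage_set f A K) =
  [&& t `<=` A, t != fset0 & f @` t \in simplices K].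
Proof. by rewrite !inE /= fpowersetE. Qed.

Lemma preimage_subproof f (A : {fset V}) K : is_complex (preimage_set f A K).
Proof.
apply/is_complexP; split=> [|s t]; rewrite !in_preimage_set ?eqxx ?andbF //.
move=> /and3P[sA s0 sK] ts t0; rewrite t0 (fsubset_trans ts sA) /=.
apply: simplex_subset sK _ _; last by rewrite imfset_eq0.
exact/subset_imfset/fsubsetP.
Qed.

Definition preimage_complex f (A : {fset V}) K : scomplex V :=
  SComplex (preimage_subproof f A K).

(* [K] and its relabelled copy are both obtained by deleting one of the twins
   [v], [w] from the complex in which [w] is added as a duplicate of [v]. *)
Lemma same_type_relabel K v w : v \in vertices K -> w \notin vertices K ->
  same_strong_homotopy_type K (image_complex (relabel v w) K).
Proof.
move=> vK wK; have vw : v != w by apply: contraNneq wK => <-.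
pose r := relabel w v; pose A := w |` vertices K.
pose M := preimage_complex r A K.
(* Points with the same image under [r] dominate each other: adding one to a simplex containing the
   other leaves its image unchanged. *)
have rM (a b : V) s : r a = r b -> a \in A -> b \in s ->
    s \in simplices M -> a |` s \in simplices M.
  move=> rab aA bs; rewrite !in_preimage_set => /and3P[sA s0 sK].
  rewrite fsubUset fsub1set aA sA /= imfsetU1 rab.
  have -> : r b |` r @` s = r @` s.
    by apply/fsetUidPr; rewrite fsub1set in_imfset.
  by rewrite sK andbT; apply/fset0Pn; exists a; rewrite !inE eqxx.
have rvw : r v = r w by rewrite /r /relabel eqxx (negPf vw).
have vA : v \in A by rewrite !inE vK orbT.
have wA : w \in A by rewrite !inE eqxx.
have vertM (u : V) : u \in A -> r u = v -> [fset u] \in simplices M.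
  move=> uA ru; rewrite in_preimage_set fsub1set uA fset1_neq0.
  by rewrite imfset_fset1 ru -vertexP.
have rv : r v = v by rewrite rvw /r /relabel eqxx.
have KM : deletion M w = K.
  apply: scomplex_eq; apply/fsetP => s; rewrite !inE /= fpowersetE.
  apply/idP/idP => [/andP[/and3P[_ _ sK] ws]|sK].
    by move: sK; rewrite /r relabel_imfset_notin.
  have ws : w \notin s by apply: contra wK => /(simplex_mem_vertices sK).
  rewrite /r relabel_imfset_notin // sK ws (simplex_neq0 sK) !andbT.
  by apply: fsubset_trans (simplex_vertices sK) _; exact: fsubsetUr.
have KM' : deletion M v = image_complex (relabel v w) K.
  apply: scomplex_eq; apply/fsetP => t; rewrite !inE /= fpowersetE.
  have cancel_r s : v \notin s -> relabel v w @` (r @` s) = s.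
    move=> vs; rewrite -imfset_comp_fset; apply: imfset_id_in => u us.
    rewrite /r /relabel /=; case: (eqVneq u w) => [->|_]; first by rewrite eqxx.
    by case: eqP => // uv; rewrite uv (negPf vs) in us.
  apply/andP/imfsetP => [[/and3P[_ _ tK] vt]|[s /= sK ->]].
    by exists (r @` t); rewrite ?cancel_r.
  have rs : r @` (relabel v w @` s) = s.
    rewrite -imfset_comp_fset; apply: imfset_id_in => u us.
    rewrite /r /relabel /=; case: (eqVneq u v) => [->|_]; first by rewrite eqxx.
    by case: eqP => // uw; rewrite -uw (simplex_mem_vertices sK us) in wK.
  rewrite rs sK imfset_eq0 (simplex_neq0 sK) !andbT; split.
    apply/fsubsetP => _ /imfsetP[u /= us ->].
    rewrite /relabel; case: eqP => // _.
    by rewrite !inE (simplex_mem_vertices sK us) orbT.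
  apply/imfsetP => -[u /= us]; rewrite /relabel.
  case: (eqVneq u v) => [_ /eqP|uv /eqP]; first by rewrite (negPf vw).
  by rewrite eq_sym (negPf uv).
apply: (@rt_trans _ _ _ M); apply: rt_step; [right|left]; apply: rt_step.
  exists w; split=> //; apply/dominatedP; split; first by rewrite vertM // -rvw.
  by exists v => // s sM ws; apply: rM ws sM.
exists v; split=> //; apply/dominatedP; split; first by rewrite vertM.
by exists w => [|s sM vs]; [rewrite eq_sym|apply: rM vs sM].
Qed.

(** The vertices are renamed one at a time: [F l] has renamed those in [l]. Injectivity and
    disjointness ensure that each new name is still free when it is introduced. *)
Lemma same_type_image_disjoint K f : {in vertices K &, injective f} ->
  {in vertices K, forall v, f v \notin vertices K} ->
  same_strong_homotopy_type K (image_complex f K).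
Proof.
move=> finj fK; pose F (l : seq V) u := if u \in l then f u else u.
suff FK (l : seq V) : uniq l -> {subset l <= vertices K} ->
    same_strong_homotopy_type K (image_complex (F l) K).
  rewrite (@eq_image_complex _ f (F (enum_fset (vertices K)))) => [|v vK].
    by apply: FK => //; exact: fset_uniq.
  by rewrite /F ifT.
elim: l => [_ _|v l IHl /= /andP[vl ul] lK].
  by rewrite image_complex_id //; exact: rt_refl.
have vK : v \in vertices K by apply: lK; rewrite inE eqxx.
have {}lK : {subset l <= vertices K}.
  by move=> u ul'; apply: lK; rewrite inE ul' orbT.
apply: (rt_trans _ _ _ _ _ (IHl ul lK)).
rewrite (@eq_image_complex _ (F (v :: l)) (relabel v (f v) \o F l)).
  rewrite image_complex_comp; apply: same_type_relabel.
    rewrite vertices_image; apply/imfsetP; exists v => //.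
    by rewrite /F (negPf vl).
  rewrite vertices_image; apply/imfsetP => -[u /= uK].
  rewrite /F; case: ifP => [ul' /finj uv|_ fvu].
    by rewrite uv ?ul' in vl.
  by have := fK _ vK; rewrite fvu uK.
move=> u uK; rewrite /F /relabel /= inE.
case: (eqVneq u v) => [->|uv] /=; first by rewrite (negPf vl) eqxx.
case: ifP => ul'; last by rewrite (negPf uv).
by case: eqP => // fuv; have := fK _ uK; rewrite fuv vK.
Qed.

Lemma fresh_injection (A B : {fset V}) : infinite_set [set: V]%classic ->
  exists f : V -> V, {in A &, injective f} /\ {in A, forall v, f v \notin B}.
Proof.
move=> Vinf.
have Binf : infinite_set ([set: V] `\` [set` B])%classic.
  exact/infinite_setD/finite_fset.
have [C CB AC] := infinite_set_fset #|` A| Binf.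
(* Elements of [A] and [C] are matched by position. The default [v] is never reached on [A], since
   [C] has at least as many elements. *)
pose f (v : V) := nth v (enum_fset C) (index v (enum_fset A)).
have fC v : v \in A -> (index v (enum_fset A) < size (enum_fset C))%N.
  by move=> vA; apply: leq_trans AC; rewrite index_mem.
exists f; split=> [u v uA vA|v vA].
  rewrite /f (set_nth_default u v) ?fC // => /eqP.
  rewrite nth_uniq ?fC ?fset_uniq // => /eqP uv.
  by rewrite -(nth_index u uA) uv nth_index.
have : f v \in C by apply: mem_nth; exact: fC.
by move=> /CB[_ /negP].
Qed.

(** The vertices of [K] and of its image may overlap, so both are renamed to a third copy, given by
    [h], that is disjoint from both. *)
Lemma same_type_image K f g : infinite_set [set: V]%classic ->
  {in vertices K, g \o f =1 id} ->
  same_strong_homotopy_type K (image_complex f K).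
Proof.
move=> Vinf gfK; set L := image_complex f K.
have [h [hinj hfresh]] :=
  fresh_injection (vertices K) (vertices K `|` vertices L) Vinf.
have gL v : v \in vertices L -> g v \in vertices K /\ f (g v) = v.
  rewrite vertices_image => /imfsetP[u /= uK ->].
  by have /= -> := gfK _ uK.
apply: (@rt_trans _ _ _ (image_complex h K)).
  apply: same_type_image_disjoint hinj _ => v vK.
  by apply: contra (hfresh _ vK); rewrite inE => ->.
apply: same_type_sym.
have -> : image_complex h K = image_complex (h \o g) L.
  rewrite -image_complex_comp; apply: eq_image_complex => v vK /=.
  by have /= -> := gfK _ vK.
apply: same_type_image_disjoint => [u v uL vL /= |v vL /=].
  have [[guK <-] [gvK <-]] := (gL _ uL, gL _ vL).
  have /= -> := gfK _ guK; have /= -> := gfK _ gvK.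
  by move=> /hinj ->.
have [gvK _] := gL _ vL.
by apply: contra (hfresh _ gvK); rewrite inE orbC => ->.
Qed.

Lemma strong_equivalent_same_type K L : infinite_set [set: V]%classic ->
  strong_equivalent K L -> same_strong_homotopy_type K L.
Proof.
move=> Vinf KL.
have [[K0 KK0 minK0] [L0 LL0 minL0]] := (strong_core K, strong_core L).
have K0L0 : strong_equivalent K0 L0.
  apply: strong_equivalent_trans (strong_collapse_equivalent LL0).
  apply: strong_equivalent_trans KL.
  exact/strong_equivalent_sym/strong_collapse_equivalent.
have [f [g [L0E gf]]] := minimal_equivalent_iso minK0 minL0 K0L0.
apply: (rt_trans _ _ _ _ _ (strong_collapse_same_type KK0)).
apply: rt_trans (same_type_sym (strong_collapse_same_type LL0)).
by rewrite L0E; exact: same_type_image gf.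
Qed.

End Relabelling.

(** * Continuity and order in finite spaces *)

Section FiniteSpaces.
Local Open Scope classical_set_scope.
Local Open Scope ring_scope.
Context {dX dY : Order.disp_t} {X : finPOrderType dX} {Y : finPOrderType dY}.

Definition minimal_open {d} {T : finPOrderType d} (y : T) :
  set (finite_space T) := [set x | (x <= y :> T)%O].

Lemma nbhs_minimal_open {d} {T : finPOrderType d} (y : finite_space T) :
  nbhs y (minimal_open y).
Proof.
apply: open_nbhs_nbhs; split; last exact: lexx.
by move=> a b ab /=; exact: le_trans.
Qed.

Lemma minimal_open_sub {d} {T : finPOrderType d} (y : finite_space T)
  (A : set (finite_space T)) : nbhs y A -> minimal_open y `<=` A.
Proof.
rewrite nbhsE => -[B [oB By] BA] x xy; apply: BA.
exact: (oB : downset _) xy By.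
Qed.

Lemma continuous_homo (f : finite_space X -> finite_space Y) :
  continuous f -> {homo (f : X -> Y) : x y / (x <= y)%O}.
Proof.
move=> cf x y xy.
have /(minimal_open_sub)/(_ x xy) := cf y _ (nbhs_minimal_open (f y)).
by [].
Qed.

(** Continuity at [(y, t)] gives a product neighbourhood, whose first factor contains everything
    below [y]. Allowing [x] below [y], rather than only [x = y], also yields monotonicity of [H] at
    time [t] by taking [s = t]. *)
Lemma homotopy_locally_below (R : realType)
    (H : finite_space X * R -> finite_space Y) (t : R) :
  {within [set: finite_space X] `*` `[0, 1], continuous H} -> t \in `[0, 1] ->
  \forall s \near t, s \in `[0, 1] ->
    forall x y : X, (x <= y)%O -> (H (x, s) <= H (y, t) :> Y)%O.
Proof.
move=> /subspace_continuousP cH t01.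
(* Finiteness of [X] allows the neighbourhoods of [t] for the various [y] to be intersected. *)
suff /filter_forall : forall y : X, \forall s \near t, s \in `[0, 1] ->
    forall x : X, (x <= y)%O -> (H (x, s) <= H (y, t) :> Y)%O.
  by apply: filterS => s Hs s01 x y xy; exact: Hs.
move=> y.
have [] := cH (y, t) (conj I t01) _ (nbhs_minimal_open (H (y, t))).
move=> [A B] /= [yA tB] AB; apply: filterS tB => s Bs s01 x xy.
by apply: (AB (x, s)) => //; split=> //; exact: minimal_open_sub yA _ xy.
Qed.

End FiniteSpaces.

(** The part of the interval where [P] holds is nonempty and relatively open and closed, hence
    everything by connectedness. *)
Lemma unit_interval_locally_constant (R : realType) (P : set R) :
  (forall t : R, t \in `[0, 1]%R -> \forall s \near t,
     s \in `[0, 1]%R -> (P s <-> P t)) ->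
  P 0%R -> P 1%R.
Proof.
move=> Ploc P0; pose I : set R := [set` `[0, 1]%R]%classic.
have I0 : I 0%R by rewrite /I set_itvcc /= lexx ler01.
have I1 : I 1%R by rewrite /I set_itvcc /= lexx ler01.
(* The connectedness criterion uses open and closed sets of [R], so a relatively open [Q] is
   exhibited as the trace of an interior taken in [R]. *)
have open_part (Q : set R) :
    (forall t, I t -> Q t -> \forall s \near t, I s -> Q s) ->
    (I `&` Q = I `&` [set t | \forall s \near t, I s -> Q s]°)%classic.
  move=> Qloc; apply/seteqP; split=> [t [It Qt]|t [It]].
    split=> //; rewrite /interior; have := Qloc _ It Qt.
    exact: nbhs_interior.
  by move=> /interior_subset/nbhs_singleton/(_ It).
suff /seteqP[_ /(_ 1%R I1)[]] : (I `&` P = I)%classic by [].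
apply: (@segment_connected R 0%R 1%R); first by exists 0%R.
- eexists; last first.
    by apply: open_part => t It Pt; apply: filterS (Ploc _ It) => s Ps /Ps ->.
  exact: open_interior.
(* The same construction for the complement of [P] gives an open set meeting [I] exactly where [P]
   fails. *)
- exists (~` [set t | \forall s \near t, I s -> (~` P) s]°)%classic.
    by apply: open_closedC; exact: open_interior.
  rewrite -setDE -[RHS]set0U -(setDv I) -setDIr -open_part.
    by rewrite setDIr setDv set0U setDE setCK.
  by move=> t It nPt; apply: filterS (Ploc _ It) => s Pst /Pst Ps /Ps.
Qed.

(** * Selections of monotone maps, and their behaviour under homotopy *)

Section Selections.
Local Open Scope fset_scope.
Context {V : choiceType}.
Implicit Types (K L M : scomplex V).

Definition selection K L (F : face_poset K -> face_poset L) (f : V -> V) :=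
  forall (x : face_poset K) v, v \in fsval x -> f v \in fsval (F x).

(** It suffices to choose [f v] in the value of [F] at the simplex with sole vertex [v]: by
    monotonicity that value lies inside [F x] whenever [v] is in [x]. *)
Lemma selection_exists K L (F : face_poset K -> face_poset L) :
  {homo F : x y / (x <= y)%O} -> exists f, selection F f.
Proof.
move=> Fmono.
have /choice[f fP] : forall v, exists w, forall vK : [fset v] \in simplices K,
    w \in fsval (F [` vK]).
  move=> v; have [vK|nvK] := pselect ([fset v] \in simplices K); last first.
    by exists v.
  have /fset0Pn[w wF] := simplex_neq0 (fsvalP (F [` vK])).
  by exists w => vK'; rewrite (bool_irrelevance vK' vK).
exists f => x v vx.
have vK : [fset v] \in simplices K.
  by rewrite -vertexP; exact: simplex_mem_vertices (fsvalP x) vx.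
have /fsubsetP : fsval (F [` vK]) `<=` fsval (F x).
  by apply: Fmono; rewrite /Order.le /= /face_le /= fsub1set.
by apply.
Qed.

Lemma selection_subset K L (F : face_poset K -> face_poset L) f
  (x : face_poset K) : selection F f -> f @` fsval x `<=` fsval (F x).
Proof. by move=> Ff; apply/fsubsetP => _ /imfsetP[v /= /Ff ? ->]. Qed.

(** Both images of a simplex lie in the single simplex that is its value under [F]. *)
Lemma selection_contiguous K L (F : face_poset K -> face_poset L) f g :
  selection F f -> selection F g -> contiguous K L f g.
Proof.
move=> Ff Fg s sK; apply: simplex_subset (fsvalP (F [` sK])) _ _.
  by rewrite fsubUset !(selection_subset [` sK]).
by rewrite fsetU_eq0 imfset_eq0 (negPf (simplex_neq0 sK)).
Qed.

Lemma selection_simplicial K L (F : face_poset K -> face_poset L) f :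
  selection F f -> simplicial K L f.
Proof.
by move=> Ff s sK; have := selection_contiguous Ff Ff sK; rewrite fsetUid.
Qed.

Lemma selection_le K L (F G : face_poset K -> face_poset L) f :
  (forall x, F x <= G x)%O -> selection F f -> selection G f.
Proof. by move=> FG Ff x v /Ff; apply/fsubsetP/FG. Qed.

Lemma selection_comp K L M (F : face_poset K -> face_poset L)
  (G : face_poset L -> face_poset M) f g :
  selection F f -> selection G g -> selection (G \o F) (g \o f).
Proof. by move=> Ff Gg x v /Ff/Gg. Qed.

Lemma homotopic_contiguity (R : realType) K L
    (F G : face_space K -> face_space L) f g :
  homotopic R F G -> selection F f -> selection G g -> contiguity K L f g.
Proof.
move=> [H [cH H0 H1]] Ff Gg.
(* For [s] near [t], selections at time [s] are also selections at time [t], where any two are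
   contiguous; so [P] is locally constant. *)
pose P t := forall k, selection (fun x => H (x, t)) k -> contiguity K L f k.
suff : P 1%R by apply=> x; rewrite H1; exact: Gg.
have below := homotopy_locally_below cH.
apply: (@unit_interval_locally_constant R P) => [t t01|k Hk]; last first.
  apply: rt_step; apply: (selection_contiguous Ff) => x.
  by rewrite -H0; exact: Hk.
have := below t t01; apply: filterS => s ts s01.
have le_st : forall x, (H (x, s) <= H (x, t) :> face_poset L)%O.
  by move=> x; exact: ts.
split=> [Ps k Hk|Pt k /(selection_le le_st)/Pt //].
(* To pass from [s] to [t], some selection at time [s] is needed as a link; the required
   monotonicity comes from [below] at [s] itself. *)
have [|k' Hk'] := @selection_exists K L (fun x => H (x, s)).
  by move=> x y; exact: (nbhs_singleton (below s s01)).
apply: rt_trans (Ps _ Hk') _; apply: rt_step.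
by apply: selection_contiguous Hk; exact: selection_le Hk'.
Qed.

Lemma homotopy_equivalent_strong (R : realType) K L :
  homotopy_equivalent R (face_space K) (face_space L) -> strong_equivalent K L.
Proof.
move=> [F [G [cF cG GF FG]]].
have [f Ff] := selection_exists (continuous_homo cF).
have [g Gg] := selection_exists (continuous_homo cG).
exists f, g; split.
- exact: selection_simplicial Ff.
- exact: selection_simplicial Gg.
- exact: (homotopic_contiguity GF (selection_comp Ff Gg)).
- exact: (homotopic_contiguity FG (selection_comp Gg Ff)).
Qed.

End Selections.

Theorem theorem4p19 (R : realType) (V : choiceType)
    (V_infinite : infinite_set [set: V]%classic) (K L : scomplex V) :
  homotopy_equivalent R (face_space K) (face_space L) ->
  same_strong_homotopy_type K L.
Proof.
by move=> /homotopy_equivalent_strong; exact: strong_equivalent_same_type.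
Qed.
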